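(* Let $\mu=(\mu_0,\mu_1,\dots,\mu_k)$ be a vectorial measure whose components are infinitely supported, compactly supported positive Borel measures on $\mathbb{C}$ with finite moments. If $\mu$ is matrix sequentially dominated ($\mu\in MSD$), then $\mu$ is essentially sequentially dominated.
   Context: The moment matrix of a measure $\mu$ on $\mathbb{C}$ is $\mathbf{M}(\mu)=(c_{n,m})_{n,m=0}^{\infty}$ with $c_{n,m}=\int z^n\overline{z}^m\,d\mu$. For infinite Hermitian matrices, $\mathbf{B}\le\mathbf{A}$ means $v\mathbf{B}v^*\le v\mathbf{A}v^*$ for every complex row sequence $v$ with finitely many nonzero entries. A vectorial measure $\mu=(\mu_0,\dots,\mu_k)$ is matrix sequentially dominated ($\mu\in MSD$) if there is $C>0$ with $\mathbf{M}(\mu_j)\le C\,\mathbf{M}(\mu_{j-1})$ for every $j=1,\dots,k$. A vectorial measure $\nu=(\nu_0,\dots,\nu_k)$ is sequentially dominated if $\nu_0$ is infinitely supported and there is a constant $C>0$ with $\nu_j\le C\nu_{j-1}$ (as measures) for every $j=1,\dots,k$; equivalently $\nu_0$ is infinitely supported, $\mathrm{supp}(\nu_j)\subset\mathrm{supp}(\nu_{j-1})$ and $d\nu_j=f_{j-1}\,d\nu_{j-1}$ with $f_{j-1}\in L^{\infty}(\nu_{j-1})$. The Sobolev norm of $\mu$ on the space $\mathbb{P}[z]$ of complex polynomials is $\|p\|_{\mu}^2=\sum_{j=0}^k\int|p^{(j)}|^2\,d\mu_j$. $\mu$ is essentially sequentially dominated if its Sobolev norm is equivalent on $\mathbb{P}[z]$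 to the Sobolev norm of some sequentially dominated vectorial measure. *)

(* Defs.v *)
From HB Require Import structures.
From mathcomp Require Export all_boot all_order all_algebra.
From mathcomp Require Export all_classical all_reals all_analysis.
From mathcomp Require Export complex.

Set Implicit Arguments.
Unset Strict Implicit.
Unset Printing Implicit Defensive.

Import Order.TTheory GRing.Theory Num.Theory.

Local Open Scope classical_set_scope.
Local Open Scope ring_scope.
Local Open Scope complex_scope.

(* The alias [^o] is what carries the norm topology on the field R[i]. *)
Notation borelC R := (g_sigma_algebraType (@open (complex R)^o)).
Notation Cmeasure R := {measure set (borelC R) -> \bar R}.

Section MomentMatrices.
Variable R : realType.

Definition msupport (mu : Cmeasure R) : set (complex R)^o :=
  [set z | forall U : set (complex R)^o, open U -> U z -> (0 < mu U)%E].

Definition infinitely_supported (mu : Cmeasure R) : Prop :=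
  infinite_set (msupport mu).

Definition compactly_supported (mu : Cmeasure R) : Prop :=
  compact (msupport mu).

Definition finite_moments (mu : Cmeasure R) : Prop :=
  forall n : nat,
    (\int[mu]_z ((Normc.normc (z : R[i]) ^+ n)%:E) < +oo)%E.

Definition complex_integral (mu : Cmeasure R) (f : R[i] -> R[i]) :
  R[i] :=
  (\int[mu]_z complex.Re (f z))%R +i* (\int[mu]_z complex.Im (f z))%R.

Definition moment_matrix (mu : Cmeasure R) : nat -> nat -> R[i] :=
  fun n m => complex_integral mu (fun z => z ^+ n * z^* ^+ m).

(* The value v A v^* for a row v whose entries of index >= N vanish. *)
Definition mx_form (A : nat -> nat -> R[i]) (N : nat) (v : nat -> R[i]) : R[i] :=
  \sum_(n < N) \sum_(m < N) v n * A n m * (v m)^*.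

(* On R[i], x <= y means that y - x is a nonnegative real, so the forms being
   compared need not be coerced to R. *)
Definition mx_le (B A : nat -> nat -> R[i]) : Prop :=
  forall (N : nat) (v : nat -> R[i]), (forall n, (N <= n)%N -> v n = 0) ->
    mx_form B N v <= mx_form A N v.

Section VectorialMeasures.
Variable k : nat.
Implicit Types (mu nu : 'I_k.+1 -> Cmeasure R).

Definition vectorial_measure mu : Prop :=
  forall j, compactly_supported (mu j) /\ finite_moments (mu j).

(* For j : 'I_k, [lift ord0 j] has value j + 1 and [widen_ord _ j] has
   value j; the pair ranges over (1, 0), ..., (k, k - 1). *)
Definition matrix_sequentially_dominated mu : Prop :=
  exists2 C : R, 0 < C & forall j : 'I_k,
    mx_le (moment_matrix (mu (lift ord0 j)))
      (fun n m => C%:C * moment_matrix (mu (widen_ord (leqnSn k) j)) n m).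

Definition sequentially_dominated nu : Prop :=
  infinitely_supported (nu ord0) /\
  exists2 C : R, 0 < C & forall (j : 'I_k) (A : set (borelC R)),
    measurable A ->
    (nu (lift ord0 j) A <= C%:E * nu (widen_ord (leqnSn k) j) A)%E.

Definition sobolev_norm mu (p : {poly R[i]}) : R :=
  Num.sqrt (\sum_(j < k.+1)
    \int[mu j]_z (Normc.normc (p^`(j)).[(z : R[i])] ^+ 2)).

Definition equivalent_norms (N1 N2 : {poly R[i]} -> R) : Prop :=
  exists c1 c2 : R, [/\ 0 < c1, 0 < c2 &
    forall p : {poly R[i]}, c1 * N2 p <= N1 p <= c2 * N2 p].

Definition essentially_sequentially_dominated mu : Prop :=
  exists nu, [/\ vectorial_measure nu, sequentially_dominated nu &
    equivalent_norms (sobolev_norm mu) (sobolev_norm nu)].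

End VectorialMeasures.
End MomentMatrices.

(* Main.v *)
(** With nu_j = mu_j + ... + mu_k the vector nu is sequentially dominated with
    constant 1. Domination of moment matrices says that
    int |q|^2 d mu_j <= C int |q|^2 d mu_(j-1) for every polynomial q; iterating,
    int |q|^2 d nu_j is at most a constant times int |q|^2 d mu_j. Taking for q
    the j-th derivative of p and summing over j gives the equivalence of norms. *)
Require Import Defs.
From mathcomp Require Import measurable_realfun.

Set Implicit Arguments.
Unset Strict Implicit.
Unset Printing Implicit Defensive.

Import Order.TTheory GRing.Theory Num.Theory numFieldNormedType.Exports.

Local Open Scope classical_set_scope.
Local Open Scope ring_scope.
Local Open Scope complex_scope.

(** * Measurability of complex-valued functions and of the modulus *)

Section ComplexFunctions.
Variable R : realType.
Implicit Types (f g : R[i] -> R[i]) (z : R[i]).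

Local Notation mfun h := (measurable_fun setT (h : borelC R -> R)).

(** A Lipschitz map is continuous, so the preimage of an open interval is open and thus a generator
    of the Borel sigma-algebra; open intervals generate the Borel sets of the line. The modulus on
    [R[i]] takes values in [R[i]], hence the injection [%:C] in the bound. *)
Lemma lipschitz_borelC_measurable (h : R[i] -> R) :
  (forall z w, (`|h z - h w|)%:C <= `|z - w|) -> mfun h.
Proof.
move=> hL; apply: (measurability _ (RGenOpens.measurableE R)).
move=> _ [_ [a [b ->] <-]]; rewrite setTI; apply: sub_sigma_algebra.
suff /continuousP : continuous (h : (complex R)^o -> R^o).
  by apply; exact: interval_open.
move=> z B /nbhs_ballP[e e0 eB].
apply/(@nbhs_ballP _ (complex R)^o); exists e%:C; first by rewrite /= ltcR.
move=> w zw; apply: eB; move: zw; rewrite -!ball_normE /= => zw; rewrite -ltcR.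
exact: le_lt_trans (hL z w) zw.
Qed.

(** Componentwise, to match [complex_integral], which integrates real and imaginary parts
    separately. *)
Definition cmeasurable f : Prop :=
  mfun (fun z => complex.Re (f z)) /\ mfun (fun z => complex.Im (f z)).

Lemma cmeasurable_id : cmeasurable id.
Proof.
split; apply: lipschitz_borelC_measurable => z w.
  by have := normc_ge_Re (z - w); case: z => a b; case: w.
(* Up to sign, the imaginary part is the real part after multiplication by ['i], which preserves the
   modulus. *)
have := normc_ge_Re ((z - w) * 'i); rewrite ReiNIm normrN.
rewrite normrM (_ : `|'i : R[i]| = 1) ?mulr1; first by case: z => a b; case: w.
by rewrite normc_def /= expr0n expr1n add0r sqrtr1.
Qed.

Lemma cmeasurable_cst (c : R[i]) : cmeasurable (fun=> c).
Proof. by split; exact: measurable_cst. Qed.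

Lemma cmeasurableM f g :
  cmeasurable f -> cmeasurable g -> cmeasurable (fun z => f z * g z).
Proof.
move=> [fr fi] [gr gi]; split.
  under [X in measurable_fun _ X]eq_fun => z.
    rewrite (_ : complex.Re _ = complex.Re (f z) * complex.Re (g z) -
      complex.Im (f z) * complex.Im (g z)); last by case: (f z); case: (g z).
    over.
  by apply: measurable_funB; apply: measurable_funM.
under [X in measurable_fun _ X]eq_fun => z.
  rewrite (_ : complex.Im _ = complex.Re (f z) * complex.Im (g z) +
    complex.Im (f z) * complex.Re (g z)); last by case: (f z); case: (g z).
  over.
by apply: measurable_funD; apply: measurable_funM.
Qed.

Lemma cmeasurable_conj f : cmeasurable f -> cmeasurable (fun z => (f z)^*).
Proof.
move=> [fr fi]; split.
  under [X in measurable_fun _ X]eq_fun => z.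
    rewrite (_ : complex.Re _ = complex.Re (f z)); last by case: (f z).
    over.
  exact: fr.
under [X in measurable_fun _ X]eq_fun => z.
  rewrite (_ : complex.Im _ = - complex.Im (f z)); last by case: (f z).
  over.
exact: measurable_funN.
Qed.

Lemma cmeasurableX f n : cmeasurable f -> cmeasurable (fun z => f z ^+ n).
Proof.
move=> mf; elim: n => [|n IHn]; first exact: cmeasurable_cst.
by under eq_fun do rewrite exprS; exact: cmeasurableM.
Qed.

Lemma normc_mulJ z : z * z^* = (Normc.normc z ^+ 2)%:C.
Proof. by rewrite -sqr_normc rmorphXn. Qed.

Lemma normcX z n : Normc.normc (z ^+ n) = Normc.normc z ^+ n.
Proof.
elim: n => [|n IHn]; first by rewrite !expr0 Normc.normc1.
by rewrite !exprS Normc.normcM IHn.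
Qed.

Lemma normc_conj z : Normc.normc z^* = Normc.normc z.
Proof. by case: z => a b /=; rewrite sqrrN. Qed.

Lemma normc_ge0 z : 0 <= Normc.normc z.
Proof. by case: z => a b; exact: sqrtr_ge0. Qed.

Lemma normr_Re_le z : `|complex.Re z| <= Normc.normc z.
Proof. by rewrite -lecR; exact: normc_ge_Re. Qed.

Lemma normr_Im_le z : `|complex.Im z| <= Normc.normc z.
Proof.
case: z => a b /=; rewrite -sqrtr_sqr; apply: ler_wsqrtr.
by rewrite lerDr sqr_ge0.
Qed.

Lemma cmeasurable_normc f :
  cmeasurable f -> mfun (fun z => Normc.normc (f z)).
Proof.
move=> [fr fi].
under [X in measurable_fun _ X]eq_fun => z.
  rewrite (_ : Normc.normc _ =
    Num.sqrt (complex.Re (f z) ^+ 2 + complex.Im (f z) ^+ 2)); last by case: (f z).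
  over.
apply: (measurableT_comp
  (continuous_measurable_fun (@sqrt_continuous R))).
by apply: measurable_funD;
  apply: measurable_funX.
Qed.

(** * Linearity of the complex integral *)

Variable mu : Cmeasure R.

Definition cintegrable f : Prop :=
  mu.-integrable setT (EFin \o (fun z => complex.Re (f z))) /\
  mu.-integrable setT (EFin \o (fun z => complex.Im (f z))).

Lemma cintegrable0 : cintegrable (fun=> 0).
Proof. by split; exact: integrable0. Qed.

Lemma cintegrableD f g :
  cintegrable f -> cintegrable g -> cintegrable (fun z => f z + g z).
Proof.
move=> [fr fi] [gr gi]; split.
  have := integrableD measurableT fr gr; apply: eq_integrable => // z _.
  by rewrite /=; case: (f z); case: (g z).
have := integrableD measurableT fi gi; apply: eq_integrable => // z _.
by rewrite /=; case: (f z); case: (g z).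
Qed.

Lemma complex_integralD f g : cintegrable f -> cintegrable g ->
  complex_integral mu (fun z => f z + g z) =
  complex_integral mu f + complex_integral mu g.
Proof.
move=> [fr fi] [gr gi]; rewrite /complex_integral; simpc; congr (_ +i* _).
  rewrite -RintegralD //; apply: eq_Rintegral => z _.
  by case: (f z); case: (g z).
rewrite -RintegralD //; apply: eq_Rintegral => z _.
by case: (f z); case: (g z).
Qed.

Lemma cintegrableZ c f : cintegrable f -> cintegrable (fun z => c * f z).
Proof.
case: c => a b [fr fi]; split.
  have := integrableB measurableT (integrableZl measurableT a fr)
    (integrableZl measurableT b fi); apply: eq_integrable => // z _.
  by rewrite /=; case: (f z).
have := integrableD measurableT (integrableZl measurableT a fi)
    (integrableZl measurableT b fr); apply: eq_integrable => // z _.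
by rewrite /=; case: (f z).
Qed.

Lemma integrable_EFinZl (a : R) (h : R[i] -> R) :
  mu.-integrable setT (EFin \o h) ->
  mu.-integrable setT (EFin \o (fun z => a * h z)).
Proof. by move/(integrableZl measurableT a); exact: eq_integrable. Qed.

Lemma complex_integralZ c f : cintegrable f ->
  complex_integral mu (fun z => c * f z) = c * complex_integral mu f.
Proof.
case: c => a b [fr fi]; rewrite /complex_integral; simpc; congr (_ +i* _).
  rewrite -!RintegralZl // -RintegralB //; last 2 first.
  - exact: integrable_EFinZl.
  - exact: integrable_EFinZl.
  by apply: eq_Rintegral => z _; case: (f z).
rewrite -!RintegralZl // -RintegralD //; last 2 first.
- exact: integrable_EFinZl.
- exact: integrable_EFinZl.
by apply: eq_Rintegral => z _; case: (f z).
Qed.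

Lemma complex_integral0 : complex_integral mu (fun=> 0) = 0.
Proof.
by rewrite /complex_integral Rintegral_cst // mul0r.
Qed.

Lemma cintegrable_sum (I : Type) (s : seq I) (F : I -> R[i] -> R[i]) :
  (forall i, cintegrable (F i)) -> cintegrable (fun z => \sum_(i <- s) F i z).
Proof.
move=> iF; elim: s => [|i s IHs].
  by under eq_fun do rewrite big_nil; exact: cintegrable0.
by under eq_fun do rewrite big_cons; exact: cintegrableD.
Qed.

Lemma complex_integral_sum (I : Type) (s : seq I) (F : I -> R[i] -> R[i]) :
  (forall i, cintegrable (F i)) ->
  complex_integral mu (fun z => \sum_(i <- s) F i z) =
  \sum_(i <- s) complex_integral mu (F i).
Proof.
move=> iF; elim: s => [|i s IHs].
  by under eq_fun do rewrite big_nil; rewrite big_nil complex_integral0.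
under eq_fun do rewrite big_cons.
by rewrite complex_integralD ?big_cons ?IHs //; exact: cintegrable_sum.
Qed.

(** * Polynomials under finite moments, and the quadratic form of the moment matrix *)

Hypothesis mu_moments : finite_moments mu.

Lemma integrable_normcX n :
  mu.-integrable setT (EFin \o (fun z => Normc.normc z ^+ n)).
Proof.
apply/integrableP; split.
  apply/measurable_EFinP; apply: measurable_funX.
  exact: cmeasurable_normc cmeasurable_id.
under eq_integral => z _ do rewrite /= ger0_norm ?exprn_ge0 ?normc_ge0 //.
exact: mu_moments.
Qed.

(** Both components of the monomial are bounded by $|z|^{n+m}$, which is integrable since all
    moments are finite. *)
Lemma cintegrable_monomial n m : cintegrable (fun z => z ^+ n * z^* ^+ m).
Proof.
have [mr mi] : cmeasurable (fun z => z ^+ n * z^* ^+ m).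
  apply: cmeasurableM; first exact: cmeasurableX cmeasurable_id.
  exact/cmeasurableX/cmeasurable_conj/cmeasurable_id.
have normE z : Normc.normc (z ^+ n * z^* ^+ m) = Normc.normc z ^+ (n + m).
  by rewrite Normc.normcM !normcX normc_conj exprD.
split; apply: (le_integrable measurableT _ _ (integrable_normcX (n + m))).
- exact/measurable_EFinP.
- move=> z _; rewrite /= lee_fin [leRHS]ger0_norm ?exprn_ge0 ?normc_ge0 //.
  by rewrite -normE; exact: normr_Re_le.
- exact/measurable_EFinP.
- move=> z _; rewrite /= lee_fin [leRHS]ger0_norm ?exprn_ge0 ?normc_ge0 //.
  by rewrite -normE; exact: normr_Im_le.
Qed.

Definition sqr_norm_integral (p : {poly R[i]}) : R :=
  (\int[mu]_z (Normc.normc p.[(z : R[i])] ^+ 2))%R.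

(** Expanding $p(z)\overline{p(z)}$ leaves exactly the monomials whose integrals are the entries of
    the moment matrix. *)
Lemma sqr_normc_horner (p : {poly R[i]}) z :
  (Normc.normc p.[z] ^+ 2)%:C =
  \sum_(n < size p) \sum_(m < size p) p`_n * (p`_m)^* * (z ^+ n * z^* ^+ m).
Proof.
rewrite -normc_mulJ horner_coef rmorph_sum mulr_suml; apply: eq_bigr => n _.
rewrite mulr_sumr; apply: eq_bigr => m _.
by rewrite rmorphM rmorphXn mulrACA.
Qed.

Lemma cintegrable_sqr_normc_horner (p : {poly R[i]}) :
  cintegrable (fun z => (Normc.normc p.[z] ^+ 2)%:C).
Proof.
under eq_fun do rewrite sqr_normc_horner.
do 2! apply: cintegrable_sum => ?.
exact/cintegrableZ/cintegrable_monomial.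
Qed.

Lemma integrable_sqr_normc_horner (p : {poly R[i]}) :
  mu.-integrable setT (EFin \o (fun z => Normc.normc p.[z] ^+ 2)).
Proof. exact: (cintegrable_sqr_normc_horner p).1. Qed.

(** The bridge from matrices to integrals: with $v$ the coefficients of $p$, integrating the
    expansion of $|p|^2$ term by term gives $v\mathbf{M}(\mu)v^*$. *)
Lemma mx_form_moment_matrix (p : {poly R[i]}) :
  mx_form (moment_matrix mu) (size p) (fun n => p`_n) =
  (sqr_norm_integral p)%:C.
Proof.
transitivity (complex_integral mu (fun z => (Normc.normc p.[z] ^+ 2)%:C)).
  under [in RHS]eq_fun do rewrite sqr_normc_horner.
  have iF n m : cintegrable (fun z => p`_n * (p`_m)^* * (z ^+ n * z^* ^+ m)).
    exact/cintegrableZ/cintegrable_monomial.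
  rewrite complex_integral_sum => [|n]; last exact: cintegrable_sum.
  apply: eq_bigr => n _; rewrite complex_integral_sum //.
  apply: eq_bigr => m _; rewrite complex_integralZ 1?mulrAC //.
  exact: cintegrable_monomial.
rewrite /complex_integral /=; congr (_ +i* _).
by rewrite Rintegral_cst // mul0r.
Qed.

Lemma sqr_norm_integral_ge0 p : 0 <= sqr_norm_integral p.
Proof. by apply: Rintegral_ge0 => z _; rewrite sqr_ge0. Qed.

End ComplexFunctions.

(** * Supports and moments of finite sums of measures *)

Section TailMeasures.
Variable R : realType.

(** A null open neighbourhood of a point outside the support is a null open neighbourhood of each of
    its points, so the complement is open. *)
Lemma msupport_closed (mu : Cmeasure R) : closed (msupport mu).
Proof.
rewrite -[msupport mu]setCK; apply: open_closedC; rewrite openE => z.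
rewrite /setC /= => /existsNP[U /not_implyP[oU /not_implyP[Uz U0]]].
apply: (@filterS _ _ (nbhs_filter (z : (complex R)^o)) U); last first.
  exact: open_nbhs_nbhs.
by move=> w Uw /(_ U oU Uw).
Qed.

(** A point outside all the supports has, for each summand, a null open neighbourhood; their finite
    intersection is a neighbourhood that is null for the sum. *)
Lemma msupport_msum (m : nat -> Cmeasure R) n :
  msupport (msum m n) `<=` \bigcup_(i < n) msupport (m i).
Proof.
move=> z zm; apply: contrapT => zN.
have /choice[U UP] (i : 'I_n) :
    exists U : set (complex R)^o, [/\ open U, U z & ~ (0 < m i U)%E].
  have : ~ msupport (m i) z by move=> mz; apply: zN; exists i => /=.
  by move=> /existsNP[U /not_implyP[oU /not_implyP[Uz U0]]]; exists U.
(* The interior makes [V] open at once; [z] lies in it because there are only finitely many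
   [U i]. *)
pose V := [set w : (complex R)^o | forall i, U i w]°.
have oV : open V by exact: open_interior.
have Vz : V z.
  apply: (@filter_forall _ _ _ _ (nbhs_filter (z : (complex R)^o))) => i.
  by apply: open_nbhs_nbhs; have [] := UP i.
have := zm V oV Vz; suff -> : (msum m n : Cmeasure R) V = 0%E by rewrite ltxx.
apply: big1 => i _.
have [oU _ /negP] := UP i; rewrite -leNgt => U0.
apply/eqP; rewrite eq_le measure_ge0 andbT; apply: le_trans U0.
apply: le_measure; rewrite ?inE; try exact: sub_sigma_algebra.
by move=> w /interior_subset.
Qed.

(** The support of the sum is a closed subset of a finite union of compact sets. *)
Lemma compactly_supported_msum (m : nat -> Cmeasure R) n :
  (forall i, compactly_supported (m i)) -> compactly_supported (msum m n).
Proof.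
move=> cm; apply: subclosed_compact (@msupport_closed _) _ (@msupport_msum _ _).
by rewrite bigcup_mkord; apply: bigsetU_compact => i _; exact: cm.
Qed.

Lemma finite_moments_msum (m : nat -> Cmeasure R) n :
  (forall i, finite_moments (m i)) -> finite_moments (msum m n).
Proof.
move=> fm d; rewrite ge0_integral_measure_sum //.
- by apply: lte_sum_pinfty => i _; exact: fm.
- by move=> z _; rewrite lee_fin exprn_ge0 ?normc_ge0.
- apply/measurable_EFinP/measurable_funX.
  exact: cmeasurable_normc (cmeasurable_id R).
Qed.

Lemma msupport_mzero : msupport (mzero : Cmeasure R) = set0.
Proof.
rewrite -subset0 => z /(_ setT openT I).
by rewrite /mzero ltxx.
Qed.

(** * The tail sums and their domination *)

Variable k : nat.
Implicit Types mu : 'I_k.+1 -> Cmeasure R.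

(** This is $\nu_j=\mu_j+\dots+\mu_k$. As [msum] takes a sequence over [nat], indices are cast by
    [inord], and those below [j] contribute the zero measure. *)
Definition tail_measure mu (j : 'I_k.+1) : Cmeasure R :=
  msum (fun i => if (j <= i)%N then mu (inord i) else mzero) k.+1.

Lemma tail_measureE mu j A :
  tail_measure mu j A = (\sum_(i < k.+1 | (j <= i)%N) mu i A)%E.
Proof.
rewrite [RHS]big_mkcond; apply: eq_bigr => i _; rewrite inord_val.
by case: ifP.
Qed.

Lemma vectorial_measure_tail mu :
  vectorial_measure mu -> vectorial_measure (tail_measure mu).
Proof.
move=> hmu j; split.
  apply: compactly_supported_msum => i; case: ifP => _; first exact: (hmu _).1.
  by rewrite /compactly_supported msupport_mzero; exact: compact0.
apply: finite_moments_msum => i; case: ifP => _; first exact: (hmu _).2.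
by move=> n; rewrite integral_measure_zero.
Qed.

(** The support of $\nu_0\ge\mu_0$ contains that of $\mu_0$, and $\nu_{j+1}$ is a sum over fewer
    indices than $\nu_j$, whence the constant 1. *)
Lemma sequentially_dominated_tail mu :
  infinitely_supported (mu ord0) -> sequentially_dominated (tail_measure mu).
Proof.
move=> inf0; split.
  apply: contra_not inf0; apply: sub_finite_set => z zmu U oU Uz.
  apply: lt_le_trans (zmu U oU Uz) _; rewrite tail_measureE.
  by rewrite (bigD1 ord0) //= leeDl // sume_ge0.
exists 1 => // j A _; rewrite mul1e !tail_measureE.
rewrite big_mkcond [leRHS]big_mkcond; apply: lee_sum => i _.
case: ifP => [ji|_]; last by case: ifP.
by rewrite ifT //; apply: leq_trans ji; rewrite lift0.
Qed.

(** The integral is additive in the measure for nonnegative functions; finite moments make every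
    summand finite, so that [fine] commutes with the sum. *)
Lemma sqr_norm_integral_tail mu j p : vectorial_measure mu ->
  sqr_norm_integral (tail_measure mu j) p =
  \sum_(i < k.+1 | (j <= i)%N) sqr_norm_integral (mu i) p.
Proof.
move=> hmu; have [_ fm] := vectorial_measure_tail hmu j.
rewrite /sqr_norm_integral /Rintegral ge0_integral_measure_sum //.
- rewrite sum_fine => [|i _]; last first.
    apply: integrable_fin_num => //; apply: integrable_sqr_normc_horner.
    exact: (hmu i).2.
  congr fine; rewrite [RHS]big_mkcond; apply: eq_bigr => i _.
  by rewrite inord_val; case: ifP => // _; rewrite integral_measure_zero.
- by move=> z _; rewrite lee_fin sqr_ge0.
- by have /measurable_int := integrable_sqr_normc_horner fm p.
Qed.

Lemma matrix_sequentially_dominated_sqr_norm mu : vectorial_measure mu ->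
  matrix_sequentially_dominated mu ->
  exists2 C : R, 0 < C & forall (j : 'I_k) p,
    sqr_norm_integral (mu (lift ord0 j)) p <=
    C * sqr_norm_integral (mu (widen_ord (leqnSn k) j)) p.
Proof.
move=> hmu [C C0 hC]; exists C => // j p.
(* The row tested is the coefficient sequence of [p], which vanishes from [size p] on. *)
have := hC j (size p) (fun n => p`_n) (@nth_default _ 0 p).
rewrite (mx_form_moment_matrix (hmu _).2).
rewrite (_ : mx_form _ _ _ = C%:C * mx_form
    (moment_matrix (mu (widen_ord (leqnSn k) j))) (size p) (fun n => p`_n)).
  by rewrite (mx_form_moment_matrix (hmu _).2) -rmorphM lecR.
rewrite /mx_form mulr_sumr; apply: eq_bigr => n _.
by rewrite mulr_sumr; apply: eq_bigr => m _; rewrite mulrCA !mulrA.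
Qed.

Lemma sobolev_normE mu p :
  sobolev_norm mu p = Num.sqrt (\sum_(j < k.+1) sqr_norm_integral (mu j) p^`(j)).
Proof. by []. Qed.

(** Induction on [i]: each of the [i - j] steps down from [i] to [j] costs one factor [D]. *)
Lemma sqr_norm_integral_le_iter mu (D : R) p (j i : 'I_k.+1) : 0 <= D ->
  (forall j : 'I_k, sqr_norm_integral (mu (lift ord0 j)) p <=
    D * sqr_norm_integral (mu (widen_ord (leqnSn k) j)) p) ->
  (j <= i)%N ->
  sqr_norm_integral (mu i) p <= D ^+ (i - j) * sqr_norm_integral (mu j) p.
Proof.
move=> D0 hD; case: i => i; elim: i => [|i IHi] ik /= ji.
  by rewrite (_ : Ordinal ik = j) ?mul1r //; apply/val_inj/esym/eqP; rewrite -leqn0.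
move: ji; rewrite leq_eqVlt => /orP[/eqP ji|ji].
  by rewrite (_ : Ordinal ik = j) ?ji ?subnn ?mul1r //; exact: val_inj.
(* [hD] at [i'] compares the indices [i.+1] and [i], the lift and the widening of [i']. *)
pose i' : 'I_k := Ordinal (ik : (i < k)%N).
have -> : Ordinal ik = lift ord0 i' by exact: val_inj.
apply: le_trans (hD i') _; rewrite subSn // exprS -mulrA ler_wpM2l //.
rewrite (_ : widen_ord _ _ = Ordinal (ltnW ik)); last exact: val_inj.
exact: IHi.
Qed.

End TailMeasures.

(** * Equivalence of the Sobolev norms of [mu] and of its tail sums *)

Theorem corollary3 (R : realType) (k : nat)
    (mu : 'I_k.+1 -> Cmeasure R)
    (hmu : vectorial_measure mu)
    (hinf : forall j : 'I_k.+1, infinitely_supported (mu j))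
    (hMSD : matrix_sequentially_dominated mu) :
  essentially_sequentially_dominated mu.
Proof.
exists (tail_measure mu); split; first exact: vectorial_measure_tail.
  exact: sequentially_dominated_tail.
have [D D0 hD] := matrix_sequentially_dominated_sqr_norm hmu hMSD.
(* [S] bounds every power of [D] up to the [k]-th, whether [D] is below or above 1; the factor
   [k.+1] bounds the number of terms in a tail. *)
pose S := \sum_(n < k.+1) D ^+ n; pose K := S *+ k.+1.
have K0 : 0 < K.
  rewrite pmulrn_rgt0 // /S big_ord_recl ltr_pwDl ?ltr01 // sumr_ge0 // => i _.
  by rewrite exprn_ge0 // ltW.
have tail_ge j p : sqr_norm_integral (mu j) p <=
    sqr_norm_integral (tail_measure mu j) p.
  rewrite sqr_norm_integral_tail // (bigD1 j) //= lerDl sumr_ge0 // => i _.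
  exact: sqr_norm_integral_ge0.
have tail_le (j : 'I_k.+1) p : sqr_norm_integral (tail_measure mu j) p <=
    K * sqr_norm_integral (mu j) p.
  rewrite sqr_norm_integral_tail //.
  have ij_le (i : 'I_k.+1) : (j <= i)%N ->
      sqr_norm_integral (mu i) p <= S * sqr_norm_integral (mu j) p.
    move=> ji; apply: le_trans (sqr_norm_integral_le_iter (ltW D0) _ ji) _ => //.
    apply: ler_wpM2r; first exact: sqr_norm_integral_ge0.
    (* So [D ^+ (i - j)] is one of the nonnegative terms of [S]. *)
    have ijk : (i - j < k.+1)%N by apply: leq_ltn_trans (leq_subr _ _) _.
    rewrite /S (bigD1 (Ordinal ijk)) //= lerDl sumr_ge0 // => n _.
    by rewrite exprn_ge0 // ltW.
  apply: (@le_trans _ _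
    (\sum_(i < k.+1 | (j <= i)%N) S * sqr_norm_integral (mu j) p)).
    exact: ler_sum.
  rewrite sumr_const /K mulrnAl; apply: ler_wpMn2l; last first.
    by rewrite -[leqRHS]card_ord max_card.
  rewrite mulr_ge0 ?sqr_norm_integral_ge0 // sumr_ge0 // => n _.
  by rewrite exprn_ge0 // ltW.
(* The lower constant comes from [tail_le] and the upper one from [tail_ge], both applied to the
   [j]-th derivative of [p] in the [j]-th term. *)
exists (Num.sqrt K)^-1, 1; split=> [||p]; rewrite ?invr_gt0 ?sqrtr_gt0 //.
rewrite !sobolev_normE mul1r mulrC ler_pdivrMr ?sqrtr_gt0 // mulrC.
rewrite -(sqrtrM _ (ltW K0)) mulr_sumr; apply/andP; split; apply: ler_wsqrtr.
  by apply: ler_sum => j _; exact: tail_le.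
by apply: ler_sum => j _; exact: tail_ge.
Qed.
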